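(* For all $w$ in a neighborhood of $1$ in $\mathbb{C}$, the transformation formula $$\frac{2+\sqrt{2+2w}}{4}\,F\Big(\tfrac14,\tfrac14,1;1-w^2\Big)=F\Big(\tfrac14,\tfrac14,1;1-\frac{(6\sqrt{2w+2}-w-3)^2}{(2\sqrt{2w+2}+w+3)^2}\Big)$$ holds, where $\sqrt{2+2w}$ denotes the branch taking the value $2$ at $w=1$.
   Context: $F(a,b,c;z)=\sum_{n=0}^\infty\frac{(a,n)(b,n)}{(c,n)(1,n)}z^n$ for $|z|<1$ is the hypergeometric series, where $(a,n)=a(a+1)\cdots(a+n-1)$. *)

(* Defs.v *)
From Stdlib Require Import Reals Lra.
From Coquelicot Require Import Coquelicot.
Open Scope C_scope.

(** Pochhammer symbol (a,n) = a (a+1) ... (a+n-1), with (a,0) = 1. *)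
Fixpoint pochhammer (a : C) (n : nat) : C :=
  match n with
  | O => 1
  | S m => pochhammer a m * (a + INR m)
  end.

Definition hypergeom_term (a b c z : C) (n : nat) : C :=
  (pochhammer a n * pochhammer b n) / (pochhammer c n * pochhammer 1 n) * z ^ n.

(** [iota] returns the sum whenever the series converges (in particular for
    [Cmod z < 1] and [c] not a nonpositive integer); otherwise the value is
    meaningless, as for [RInt] and [Series]. *)
Definition hypergeom (a b c z : C) : C :=
  @iota C_CompleteNormedModule
    (@is_series C_AbsRing C_NormedModule (hypergeom_term a b c z)).

(** [s] is, near [w0], the continuous branch of the square root of [f] with
    value [v0] at [w0]. Only the germ of [s] at [w0] is constrained; when
    [v0 <> 0] this germ is unique. *)
Definition is_sqrt_branch (f s : C -> C) (w0 v0 : C) : Prop :=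
  s w0 = v0 /\ locally w0 (fun w : C => continuous s w /\ s w * s w = f w).

(** A branch as in the transformation formula exists: the principal one. *)
Lemma sqrt_branch_exists :
  exists s : C -> C, is_sqrt_branch (fun w => 2 + 2 * w) s 1 2.
Proof.
pose (p := fun z : C => sqrt ((Cmod z + fst z) / 2)).
pose (r := fun z : C => (p z, (snd z / (2 * p z))%R) : C).
assert (Hfst : forall z : C, continuous (fst : C -> R) z).
{ intros z; apply continuous_fst. }
assert (Hsnd : forall z : C, continuous (snd : C -> R) z).
{ intros z; apply continuous_snd. }
assert (Hmod : forall z : C, continuous Cmod z).
{ intros z; unfold Cmod.
  apply (continuous_comp (fun z : C => (fst z ^ 2 + snd z ^ 2)%R) sqrt).
  - apply (continuous_plus (fun z : C => (fst z ^ 2)%R) (fun z : C => (snd z ^ 2)%R)).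
    + apply (continuous_comp (fst : C -> R) (fun x => x ^ 2)%R); [apply Hfst|].
      apply (ex_derive_continuous (fun x => x ^ 2)%R); auto_derive; auto.
    + apply (continuous_comp (snd : C -> R) (fun x => x ^ 2)%R); [apply Hsnd|].
      apply (ex_derive_continuous (fun x => x ^ 2)%R); auto_derive; auto.
  - apply continuous_sqrt. }
assert (Hp : forall z : C, continuous p z).
{ intros z; unfold p.
  apply (continuous_comp (fun z : C => ((Cmod z + fst z) / 2)%R) sqrt).
  - apply (continuous_comp (fun z : C => (Cmod z + fst z)%R) (fun x => x / 2)%R).
    + apply (continuous_plus Cmod (fst : C -> R)); [apply Hmod | apply Hfst].
    + apply (ex_derive_continuous (fun x => x / 2)%R); auto_derive; auto.
  - apply continuous_sqrt. }
assert (Hpos : forall z : C, (0 < fst z)%R -> (0 < p z)%R).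
{ intros z Hz; apply sqrt_lt_R0; pose proof (Cmod_ge_0 z); lra. }
assert (Hr : forall z : C, (0 < fst z)%R -> continuous r z).
{ intros z Hz; unfold r.
  assert (H2 : continuous (fun z : C => (snd z / (2 * p z))%R) z).
  { apply (continuous_mult (snd : C -> R) (fun z : C => (/ (2 * p z))%R)); [apply Hsnd|].
    apply (continuous_comp p (fun x => / (2 * x))%R); [apply Hp|].
    apply (ex_derive_continuous (fun x => / (2 * x))%R); auto_derive.
    pose proof (Hpos z Hz); lra. }
  intros P [e He].
  destruct (proj1 (filterlim_locally _ _) (Hp z) e) as [d1 Hd1].
  destruct (proj1 (filterlim_locally _ _) H2 e) as [d2 Hd2].
  exists (mkposreal _ (Rmin_stable_in_posreal d1 d2)); intros y Hy; apply He; split; simpl.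
  - apply Hd1; eapply ball_le; [|exact Hy]; apply Rmin_l.
  - apply Hd2; eapply ball_le; [|exact Hy]; apply Rmin_r. }
assert (Hsq : forall z : C, (0 < fst z)%R -> r z * r z = z).
{ intros [x y] Hz; pose proof (Hpos _ Hz) as Hp0.
  assert (E1 : (p (x, y) * p (x, y) = (Cmod (x, y) + x) / 2)%R).
  { unfold p; simpl fst; rewrite sqrt_sqrt; auto.
    simpl in Hz; pose proof (Cmod_ge_0 (x, y)); lra. }
  assert (E2 : (Cmod (x, y) * Cmod (x, y) = x * x + y * y)%R).
  { unfold Cmod; simpl fst; simpl snd; rewrite sqrt_sqrt; nra. }
  unfold r, Cmult; simpl fst; simpl snd.
  set (q := p (x, y)) in *; set (m := Cmod (x, y)) in *.
  assert (Hq : (q <> 0)%R) by lra.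
  apply injective_projections; simpl; [|now field].
  assert (E3 : (y * y = 4 * (q * q) * (q * q - x))%R) by (rewrite E1; nra).
  replace (y / (2 * q) * (y / (2 * q)))%R with (y * y / (4 * (q * q)))%R by now field.
  rewrite E3; now field. }
exists (fun w : C => r (2 + 2 * w)); split.
- assert (E : Cmod (2 + 2 * 1) = 4%R).
  { replace (2 + 2 * 1) with (RtoC 4) by (rewrite <- RtoC_mult, <- RtoC_plus; f_equal; ring).
    rewrite Cmod_R; apply Rabs_pos_eq; lra. }
  unfold r, p; rewrite E; simpl.
  replace ((4 + (2 + (2 * 1 - 0 * 0))) / 2)%R with (2 * 2)%R by field.
  rewrite sqrt_square by lra; apply injective_projections; simpl; field.
- exists (mkposreal 1 Rlt_0_1); intros w [Hw _]; change C in (type of w).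
  assert (Hw1 : (0 < fst (2 + 2 * w)%C)%R).
  { unfold ball in Hw; simpl in Hw; unfold AbsRing_ball, abs, minus, plus, opp in Hw.
    simpl in Hw; apply Rabs_def2 in Hw; simpl; lra. }
  split; [|now apply Hsq].
  apply (continuous_comp (fun u : C => 2 + 2 * u : C) r); [|now apply Hr].
  apply (continuous_plus (U := C_UniformSpace) (V := C_NormedModule)
    (fun _ : C => RtoC 2) (fun u : C => (2 * u : C))).
  + apply continuous_const.
  + apply (continuous_scal_r (K := C_AbsRing) (V := C_NormedModule) (RtoC 2) (fun w : C => w)).
    apply continuous_id.
Qed.

(* Main.v *)
Require Import Defs.
From Stdlib Require Import Reals Lra.
From Coquelicot Require Import Coquelicot.
Open Scope C_scope.

(** The formula is a Landen transformation in disguise.  Write [F] for the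
    function [F(1/4,1/4,1; .)], put [s = sqrt (2 + 2 w)] and use
    [x = (2 - s) / (2 + s)] as a local parameter, so that [w = 1] becomes
    [x = 0].  Then [w = s^2 / 2 - 1] turns all square roots into rational
    functions of [x], and the claim reads, for [x] near 0,

      [F (16 x (1 - x)^2 / (1 + x)^4) / (1 + x) = F (4 x^2 (1 - x^2))].

    By the quadratic transformation [F (4 z (1 - z)) = F(1/2,1/2,1; z)], this
    is the classical [K (2 sqrt x / (1 + x)) = (1 + x) K (x)] for the complete
    elliptic integral [K].  Accordingly both sides solve the equation of [K],

      [(x (1 - x^2) y')' = x y],

    as the chain rule and the hypergeometric equation of [F] show
    ([hypergeom_landen_of_ode]).  Both have value 1 and derivative 0 at the
    singular point 0.  Their Wronskian times [x (1 - x^2)] is constant, hence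
    zero because [x (1 - x^2)] vanishes at 0, so their quotient is constant
    ([wronskian_unique]).

    This argument uses nothing about analytic functions beyond complex
    differentiability.  It rests on three facts: a function with zero complex
    derivative on a disc is constant ([is_Cderive_zero_const]), a power series
    may be differentiated term by term inside its disc of convergence
    ([is_Cderive_pseries]), and the hypergeometric series satisfies its
    differential equation ([hypergeom_ode]). *)

(** * Complex differentiation *)

(** The target is the field normed by itself, not the plane with its product
    topology: the product rule concerns values in the normed field itself. *)
Definition is_Cderive (f : C -> C) (z l : C) : Prop :=
  @is_derive C_AbsRing (AbsRing_NormedModule C_AbsRing) f z l.

Lemma is_Cderive_intro (f : C -> C) (z l : C) :
  (forall eps : posreal, exists d : posreal, forall y : C,
    (Cmod (y - z) < d)%R ->
    (Cmod (f y - f z - (y - z) * l) <= eps * Cmod (y - z))%R) ->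
  is_Cderive f z l.
Proof.
intros H; split; [apply is_linear_scal_l|].
intros x Hx eps.
apply (@is_filter_lim_locally_unique C_AbsRing (AbsRing_NormedModule C_AbsRing)) in Hx.
subst x.
destruct (H eps) as [d Hd]; exists d; intros y Hy; exact (Hd y Hy).
Qed.

Lemma is_Cderive_elim (f : C -> C) (z l : C) :
  is_Cderive f z l ->
  forall eps : posreal, exists d : posreal, forall y : C,
    (Cmod (y - z) < d)%R ->
    (Cmod (f y - f z - (y - z) * l) <= eps * Cmod (y - z))%R.
Proof.
intros [_ H] eps.
destruct (H z (fun P HP => HP) eps) as [d Hd]; exists d; intros y Hy; exact (Hd y Hy).
Qed.

Lemma is_Cderive_eq (f : C -> C) (z l l' : C) :
  is_Cderive f z l -> l = l' -> is_Cderive f z l'.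
Proof. intros H <-; exact H. Qed.

Lemma is_Cderive_const (c z : C) : is_Cderive (fun _ => c) z 0.
Proof. exact (is_derive_const (K := C_AbsRing) (V := AbsRing_NormedModule C_AbsRing) c z). Qed.

Lemma is_Cderive_id (z : C) : is_Cderive (fun y => y) z 1.
Proof. exact (is_derive_id (K := C_AbsRing) z). Qed.

Lemma is_Cderive_plus (f g : C -> C) (z df dg : C) :
  is_Cderive f z df -> is_Cderive g z dg ->
  is_Cderive (fun y => f y + g y) z (df + dg).
Proof. exact (@is_derive_plus C_AbsRing (AbsRing_NormedModule C_AbsRing) f g z df dg). Qed.

Lemma is_Cderive_minus (f g : C -> C) (z df dg : C) :
  is_Cderive f z df -> is_Cderive g z dg ->
  is_Cderive (fun y => f y - g y) z (df - dg).
Proof. exact (@is_derive_minus C_AbsRing (AbsRing_NormedModule C_AbsRing) f g z df dg). Qed.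

Lemma is_Cderive_mult (f g : C -> C) (z df dg : C) :
  is_Cderive f z df -> is_Cderive g z dg ->
  is_Cderive (fun y => f y * g y) z (df * g z + f z * dg).
Proof.
intros Hf Hg; exact (@is_derive_mult C_AbsRing f g z df dg Hf Hg Cmult_comm).
Qed.

Lemma is_Cderive_comp (f g : C -> C) (z df dg : C) :
  is_Cderive f (g z) df -> is_Cderive g z dg ->
  is_Cderive (fun y => f (g y)) z (dg * df).
Proof. exact (@is_derive_comp C_AbsRing (AbsRing_NormedModule C_AbsRing) f g z df dg). Qed.

Lemma Cmod_minus_sym (a b : C) : Cmod (a - b) = Cmod (b - a).
Proof. rewrite <- Cmod_opp; f_equal; ring. Qed.

Lemma Cmod_le_plus_minus (a b : C) : (Cmod a <= Cmod b + Cmod (a - b))%R.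
Proof. replace a with (b + (a - b)) at 1 by ring; apply Cmod_triangle. Qed.

Lemma is_Cderive_inv (z : C) : z <> 0 -> is_Cderive Cinv z (- / (z * z)).
Proof.
intros Hz; apply is_Cderive_intro; intros eps.
pose proof (proj1 (Cmod_gt_0 z) Hz) as Hm.
set (m := Cmod z) in *.
assert (Hd : (0 < Rmin (m / 2) (eps * (m * m * m) / 2))%R).
{ pose proof (cond_pos eps).
  apply Rmin_glb_lt; [lra|].
  assert (0 < m * m * m)%R by (repeat apply Rmult_lt_0_compat; lra). nra. }
exists (mkposreal _ Hd); simpl; intros y Hy.
assert (H1 : (Cmod (y - z) < m / 2)%R) by (eapply Rlt_le_trans; [apply Hy|apply Rmin_l]).
assert (H2 : (Cmod (y - z) < eps * (m * m * m) / 2)%R)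
  by (eapply Rlt_le_trans; [apply Hy|apply Rmin_r]).
pose proof (Cmod_le_plus_minus z y) as H3.
rewrite Cmod_minus_sym in H3; fold m in H3.
assert (Hy0 : y <> 0) by (apply Cmod_gt_0; lra).
(* The remainder is exactly quadratic in [y - z], with a denominator that
   [Cmod z / 2 < Cmod y] keeps away from 0. *)
replace (/ y - / z - (y - z) * - / (z * z))
  with ((y - z) * (y - z) / (y * (z * z))) by (now field).
rewrite Cmod_div, !Cmod_mult by (repeat apply Cmult_neq_0; assumption).
fold m.
set (h := Cmod (y - z)) in *; set (k := Cmod y) in *.
assert (0 <= h)%R by apply Cmod_ge_0.
assert (Hk : (m / 2 < k)%R) by lra.
assert (Hkm : (0 < k * (m * m))%R) by (repeat apply Rmult_lt_0_compat; lra).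
apply Rmult_le_reg_r with (1 := Hkm).
replace (h * h / (k * (m * m)) * (k * (m * m)))%R with (h * h)%R by (field; lra).
replace (eps * h * (k * (m * m)))%R with (h * (eps * (m * m) * k))%R by ring.
apply Rmult_le_compat_l; [assumption|].
apply Rlt_le, Rlt_le_trans with (1 := H2).
replace (eps * (m * m * m) / 2)%R with (eps * (m * m) * (m / 2))%R by field.
apply Rmult_le_compat_l; [|lra].
apply Rmult_le_pos; [apply Rlt_le, cond_pos|nra].
Qed.

Lemma is_Cderive_div (f g : C -> C) (z df dg : C) :
  is_Cderive f z df -> is_Cderive g z dg -> g z <> 0 ->
  is_Cderive (fun y => f y / g y) z ((df * g z - f z * dg) / (g z * g z)).
Proof.
intros Hf Hg Hz; eapply is_Cderive_eq.
- apply (is_Cderive_mult f (fun y => / g y) z df); [exact Hf|].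
  exact (is_Cderive_comp Cinv g z _ _ (is_Cderive_inv _ Hz) Hg).
- field; assumption.
Qed.

Lemma is_Cderive_pow (f : C -> C) (z df : C) (n : nat) :
  is_Cderive f z df ->
  is_Cderive (fun y => f y ^ n) z (INR n * f z ^ pred n * df).
Proof.
intros Hf; induction n as [|n IH].
- eapply is_Cderive_eq; [exact (is_Cderive_const 1 z)|].
  change (RtoC (INR 0)) with (RtoC 0); ring.
- eapply is_Cderive_eq; [exact (is_Cderive_mult _ _ _ _ _ Hf IH)|].
  rewrite S_INR, RtoC_plus; destruct n as [|n]; simpl; ring.
Qed.

Lemma is_Cderive_continuous (f : C -> C) (z l : C) :
  is_Cderive f z l ->
  forall eps : posreal, exists d : posreal, forall y : C,
    (Cmod (y - z) < d)%R -> (Cmod (f y - f z) < eps)%R.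
Proof.
intros Hf eps.
destruct (is_Cderive_elim _ _ _ Hf (mkposreal 1 Rlt_0_1)) as [d Hd]; simpl in Hd.
assert (H0 : (0 < Rmin d (eps / (2 + Cmod l)))%R).
{ pose proof (Cmod_ge_0 l); apply Rmin_glb_lt; [apply cond_pos|].
  apply Rdiv_lt_0_compat; [apply cond_pos|lra]. }
exists (mkposreal _ H0); simpl; intros y Hy.
assert (H1 : (Cmod (y - z) < d)%R) by (eapply Rlt_le_trans; [apply Hy|apply Rmin_l]).
assert (H2 : (Cmod (y - z) < eps / (2 + Cmod l))%R)
  by (eapply Rlt_le_trans; [apply Hy|apply Rmin_r]).
specialize (Hd y H1).
pose proof (Cmod_le_plus_minus (f y - f z) ((y - z) * l)) as H3.
rewrite Cmod_mult in H3.
pose proof (Cmod_ge_0 l) as Hl; pose proof (Cmod_ge_0 (y - z)) as Hh.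
apply (Rmult_lt_compat_r (2 + Cmod l)) in H2; [|lra].
replace (eps / (2 + Cmod l) * (2 + Cmod l))%R with (pos eps) in H2 by (field; lra).
nra.
Qed.

(** A zero complex derivative makes [t => f (t z)] a curve with zero real
    derivative on [[0, 1]], and the mean value inequality applies to it. *)
Lemma is_Cderive_zero_const (f : C -> C) (r : R) :
  (forall z, (Cmod z < r)%R -> is_Cderive f z 0) ->
  forall z, (Cmod z < r)%R -> f z = f 0.
Proof.
intros H z Hz.
assert (E : f (RtoC 0 * z) = f (RtoC 1 * z)).
{ apply (eq_is_derive (V := C_R_NormedModule) (fun t : R => f (RtoC t * z)) 0 1);
    [|lra].
  intros t Ht.
  assert (Htz : (Cmod (t * z) < r)%R).
  { rewrite Cmod_mult, Cmod_R, Rabs_pos_eq by lra.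
    pose proof (Cmod_ge_0 z); nra. }
  split; [apply is_linear_scal_l|].
  intros x Hx eps.
  apply (@is_filter_lim_locally_unique R_AbsRing R_NormedModule) in Hx; subst x.
  assert (He : (0 < eps / (1 + Cmod z))%R).
  { pose proof (Cmod_ge_0 z); apply Rdiv_lt_0_compat; [apply cond_pos|lra]. }
  destruct (is_Cderive_elim _ _ _ (H _ Htz) (mkposreal _ He)) as [d Hd]; simpl in Hd.
  assert (H0 : (0 < d / (1 + Cmod z))%R).
  { pose proof (Cmod_ge_0 z); apply Rdiv_lt_0_compat; [apply cond_pos|lra]. }
  exists (mkposreal _ H0); intros u Hu.
  change (Rabs (u - t) < d / (1 + Cmod z))%R in Hu.
  assert (Eu : Cmod (u * z - t * z) = (Rabs (u - t) * Cmod z)%R).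
  { replace (u * z - t * z) with (RtoC (u - t) * z) by (rewrite RtoC_minus; ring).
    now rewrite Cmod_mult, Cmod_R. }
  pose proof (Cmod_ge_0 z) as Hz0; pose proof (Rabs_pos (u - t)) as Hut.
  assert (Hu1 : (Cmod (u * z - t * z) < d)%R).
  { rewrite Eu.
    apply (Rmult_lt_compat_r (1 + Cmod z)) in Hu; [|lra].
    replace (d / (1 + Cmod z) * (1 + Cmod z))%R with (pos d) in Hu by (field; lra).
    nra. }
  specialize (Hd _ Hu1); rewrite Eu in Hd.
  change (norm (minus u t)) with (Rabs (u - t)).
  rewrite <- (Cmod_norm).
  match goal with |- (Cmod ?a <= _)%R =>
    replace a with (f (u * z) - f (t * z) - (u * z - t * z) * 0) end.
  2:{ rewrite (scal_zero_r (V := C_R_NormedModule)), Cmult_0_r.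
      unfold minus, plus, opp, zero.
      apply injective_projections; simpl; unfold plus, opp, zero; simpl; ring. }
  apply Rle_trans with (1 := Hd).
  replace (eps / (1 + Cmod z) * (Rabs (u - t) * Cmod z))%R
    with (eps * Rabs (u - t) * (Cmod z / (1 + Cmod z)))%R by (field; lra).
  rewrite <- (Rmult_1_r (eps * Rabs (u - t))) at 2.
  apply Rmult_le_compat_l; [apply Rmult_le_pos; [apply Rlt_le, cond_pos|lra]|].
  apply (Rdiv_le_1 (Cmod z) (1 + Cmod z)); lra. }
rewrite Cmult_0_l, Cmult_1_l in E; now symmetry.
Qed.

(** * Complex power series *)

Definition is_Cseries (u : nat -> C) (l : C) : Prop :=
  @is_series C_AbsRing C_NormedModule u l.

(** The sum is taken with the same choice operator as in [hypergeom], so that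
    [hypergeom a b c] is convertible to the sum of its coefficient series. *)
Definition Cpseries (a : nat -> C) (z : C) : C :=
  @iota C_CompleteNormedModule
    (@is_series C_AbsRing C_NormedModule (fun n => a n * z ^ n)).

(** Moduli of the coefficients reduce questions of absolute convergence to the
    theory of real power series. *)
Definition Cradius (a : nat -> C) : Rbar := CV_radius (fun n => Cmod (a n)).

Definition Cpderive (a : nat -> C) (n : nat) : C := INR (S n) * a (S n).

Lemma is_Cseries_unique (u : nat -> C) (l l' : C) :
  is_Cseries u l -> is_Cseries u l' -> l = l'.
Proof.
exact (@filterlim_locally_unique nat C_AbsRing C_NormedModule _ _ (sum_n u) l l').
Qed.

Lemma is_Cseries_plus (u v : nat -> C) (l m : C) :
  is_Cseries u l -> is_Cseries v m -> is_Cseries (fun n => u n + v n) (l + m).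
Proof. exact (@is_series_plus C_AbsRing C_NormedModule u v l m). Qed.

Lemma is_Cseries_scal (c : C) (u : nat -> C) (l : C) :
  is_Cseries u l -> is_Cseries (fun n => c * u n) (c * l).
Proof. exact (@is_series_scal C_AbsRing C_NormedModule c u l). Qed.

Lemma is_Cseries_ext (u v : nat -> C) (l m : C) :
  is_Cseries u l -> (forall n, u n = v n) -> l = m -> is_Cseries v m.
Proof.
intros H E <-; exact (@is_series_ext C_AbsRing C_NormedModule u v l E H).
Qed.

Lemma is_Cseries_shift (u : nat -> C) (l : C) :
  is_Cseries (fun n => u (S n)) l -> is_Cseries u (l + u 0%nat).
Proof.
intros H; apply (@is_series_decr_1 C_AbsRing C_NormedModule).
replace (plus (l + u 0%nat : C_NormedModule) (opp (u 0%nat : C_NormedModule))) with (l : C_NormedModule);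
  [exact H|].
change (l = l + u 0%nat + - u 0%nat); ring.
Qed.

Lemma is_Cseries_unshift (u : nat -> C) (l : C) :
  u 0%nat = 0 -> is_Cseries u l -> is_Cseries (fun n => u (S n)) l.
Proof.
intros H0 H; apply (@is_series_incr_1 C_AbsRing C_NormedModule).
replace (plus (l : C_NormedModule) (u 0%nat : C_NormedModule)) with (l : C_NormedModule);
  [exact H|].
change (l = l + u 0%nat); rewrite H0; ring.
Qed.

Lemma Cmod_series_le (u : nat -> C) (b : nat -> R) (l : C) (m : R) :
  (forall n, (Cmod (u n) <= b n)%R) -> is_Cseries u l -> is_series b m ->
  (Cmod l <= m)%R.
Proof.
intros Hub Hu Hb.
apply (is_lim_seq_le (fun n => Cmod (sum_n u n)) (sum_n b) (Cmod l) m).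
- intros n; unfold sum_n.
  eapply Rle_trans;
    [apply (@norm_sum_n_m C_AbsRing C_NormedModule)|].
  apply sum_n_m_le; exact Hub.
- refine (filterlim_comp _ _ _ _ _ _ _ _ Hu _).
  exact (@filterlim_norm C_AbsRing C_NormedModule l).
- exact Hb.
Qed.

Lemma Cpseries_correct (a : nat -> C) (z : C) :
  Rbar_lt (Cmod z) (Cradius a) ->
  is_Cseries (fun n => a n * z ^ n) (Cpseries a z).
Proof.
intros Hz; unfold Cpseries.
apply (@iota_correct _ C_CompleteNormedModule).
assert (Hex : @ex_series C_AbsRing C_NormedModule (fun n => a n * z ^ n)).
{ apply (@ex_series_le C_AbsRing C_CompleteNormedModule) with
    (b := fun n => Rabs (Cmod (a n) * Cmod z ^ n)).
  - intros n; change (Cmod (a n * z ^ n) <= Rabs (Cmod (a n) * Cmod z ^ n))%R.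
    rewrite Cmod_mult, Cmod_pow; apply Rle_abs.
  - apply CV_disk_inside; rewrite Rabs_pos_eq by apply Cmod_ge_0; exact Hz. }
destruct Hex as [l Hl]; exists l; split; [exact Hl|].
intros l' Hl'; exact (is_Cseries_unique _ _ _ Hl Hl').
Qed.

Lemma Cpseries_unique (a : nat -> C) (z l : C) :
  is_Cseries (fun n => a n * z ^ n) l -> Cpseries a z = l.
Proof.
intros Hl; apply (@iota_unique _ C_CompleteNormedModule); [|exact Hl].
intros l' Hl'; exact (is_Cseries_unique _ _ _ Hl' Hl).
Qed.

Lemma Cpseries_0 (a : nat -> C) :
  Rbar_lt 0 (Cradius a) -> Cpseries a 0 = a 0%nat.
Proof.
intros Ha; rewrite <- Cmod_0 in Ha.
apply Cpseries_unique.
eapply is_Cseries_ext; [apply is_Cseries_shift| |].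
- eapply is_Cseries_ext; [exact (is_Cseries_scal 0 _ _ (Cpseries_correct _ _ Ha))| |reflexivity].
  intros n; instantiate (1 := fun n => a n * 0 ^ n); cbv beta; rewrite Cpow_S; ring.
- reflexivity.
- cbv beta; rewrite Cmult_0_l; simpl; ring.
Qed.

Lemma Cradius_derive (a : nat -> C) : Cradius (Cpderive a) = Cradius a.
Proof.
unfold Cradius; rewrite <- (CV_radius_derive (fun n => Cmod (a n))).
apply CV_radius_ext; intros n.
unfold Cpderive, PS_derive; rewrite Cmod_mult, Cmod_R, Rabs_pos_eq; [reflexivity|apply pos_INR].
Qed.

Lemma Cpseries_derive_correct (a : nat -> C) (z : C) :
  Rbar_lt (Cmod z) (Cradius a) ->
  is_Cseries (fun n => a n * (INR n * z ^ pred n)) (Cpseries (Cpderive a) z).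
Proof.
intros Hz; rewrite <- Cradius_derive in Hz.
eapply is_Cseries_ext; [|reflexivity|].
- apply is_Cseries_shift.
  eapply is_Cseries_ext; [exact (Cpseries_correct _ _ Hz)| |reflexivity].
  intros n; unfold Cpderive; cbv beta; simpl pred; ring.
- cbv beta; change (RtoC (INR 0)) with (RtoC 0); ring.
Qed.

Lemma Cpseries_derive_shift (a : nat -> C) (z : C) :
  Rbar_lt (Cmod z) (Cradius a) ->
  is_Cseries (fun n => INR n * a n * z ^ n) (z * Cpseries (Cpderive a) z).
Proof.
intros Hz.
eapply is_Cseries_ext;
  [exact (is_Cseries_scal z _ _ (Cpseries_derive_correct _ _ Hz))| |reflexivity].
intros [|n]; [change (RtoC (INR 0)) with (RtoC 0)|simpl pred; rewrite Cpow_S]; ring.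
Qed.

Lemma CV_radius_weight (a : nat -> R) :
  CV_radius (fun n => INR n * a n)%R = CV_radius a.
Proof.
rewrite <- (CV_radius_derive a), <- (CV_radius_incr_1 (PS_derive a)).
apply CV_radius_ext; intros [|n]; [simpl; apply Rmult_0_l|reflexivity].
Qed.

(** The second-order Taylor remainder [E n] of the [n]-th power satisfies
    [E (n + 1) = y E n + n z^(n-1) (y - z)^2], whence the bound by induction.
    The factor [r * r] on the left avoids negative exponents of [r], and
    [n^2] instead of [n (n - 1)] on the right keeps the bound of the form
    that [CV_radius_weight] sums. *)
Lemma Cpow_taylor_bound (r : R) (z y : C) (n : nat) :
  (0 < r)%R -> (Cmod z <= r)%R -> (Cmod y <= r)%R ->
  (Cmod (y ^ n - z ^ n - (y - z) * (INR n * z ^ pred n)) * (r * r)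
   <= INR n * (INR n * r ^ n) * (Cmod (y - z) * Cmod (y - z)))%R.
Proof.
intros Hr Hz Hy.
set (h2 := (Cmod (y - z) * Cmod (y - z))%R).
assert (Hh2 : (0 <= h2)%R) by (apply Rmult_le_pos; apply Cmod_ge_0).
induction n as [|n IH].
- change (RtoC (INR 0)) with (RtoC 0); simpl (_ ^ 0).
  replace (1 - 1 - (y - z) * (0 * z ^ pred 0)) with (RtoC 0) by ring.
  rewrite Cmod_0; change (INR 0) with 0%R; lra.
- set (E := y ^ n - z ^ n - (y - z) * (INR n * z ^ pred n)) in IH.
  replace (y ^ S n - z ^ S n - (y - z) * (INR (S n) * z ^ pred (S n)))
    with (y * E + INR n * z ^ pred n * ((y - z) * (y - z))).
  2:{ unfold E; rewrite S_INR, RtoC_plus.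
      destruct n as [|n]; [change (RtoC (INR 0)) with (RtoC 0)|];
        simpl pred; rewrite ?Cpow_S; ring. }
  assert (Hn : (0 <= INR n)%R) by apply pos_INR.
  assert (Hrn : (0 < r ^ n)%R) by (apply pow_lt; lra).
  assert (B1 : (Cmod (y * E) * (r * r) <= r * (INR n * (INR n * r ^ n) * h2))%R).
  { rewrite Cmod_mult, Rmult_assoc.
    apply Rmult_le_compat; [apply Cmod_ge_0| |exact Hy|exact IH].
    apply Rmult_le_pos; [apply Cmod_ge_0|nra]. }
  assert (B2 : (Cmod (INR n * z ^ pred n * ((y - z) * (y - z))) * (r * r)
                <= INR n * (r * r ^ n) * h2)%R).
  { rewrite !Cmod_mult, Cmod_R, Rabs_pos_eq, Cmod_pow by exact Hn; fold h2.
    replace (INR n * Cmod z ^ pred n * h2 * (r * r))%R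
      with (INR n * (Cmod z ^ pred n * (r * r)) * h2)%R by ring.
    apply Rmult_le_compat_r; [exact Hh2|].
    destruct n as [|n]; [change (INR 0) with 0%R; rewrite !Rmult_0_l; lra|].
    apply Rmult_le_compat_l; [exact Hn|]; simpl pred.
    replace (r * r ^ S n)%R with (r ^ n * (r * r))%R by (simpl; ring).
    apply Rmult_le_compat_r; [nra|].
    apply pow_incr; split; [apply Cmod_ge_0|exact Hz]. }
  rewrite S_INR; simpl pow.
  apply Rle_trans with
    ((Cmod (y * E) + Cmod (INR n * z ^ pred n * ((y - z) * (y - z)))) * (r * r))%R.
  { apply Rmult_le_compat_r; [nra|apply Cmod_triangle]. }
  assert (0 <= r * r ^ n * h2)%R by (apply Rmult_le_pos; [nra|exact Hh2]).
  nra.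
Qed.

(** For [z] and [y] in a disc of radius [r] smaller than the radius of
    convergence, summing the Taylor remainders of the monomials bounds the
    remainder of the series by [M |y - z|^2 / r^2], where [M] is the sum of
    the convergent series with terms [n^2 |a n| r^n]. *)
Lemma is_Cderive_pseries (a : nat -> C) (z : C) :
  Rbar_lt (Cmod z) (Cradius a) ->
  is_Cderive (Cpseries a) z (Cpseries (Cpderive a) z).
Proof.
intros Hz.
assert (Hr : exists r : R, (Cmod z < r)%R /\ Rbar_lt r (Cradius a)).
{ destruct (Cradius a) as [rho| |]; simpl in Hz; [|exists (Cmod z + 1)%R|contradiction].
  - exists ((Cmod z + rho) / 2)%R; simpl; lra.
  - simpl; split; [lra|exact I]. }
destruct Hr as [r [Hzr Hr]].
assert (Hr0 : (0 < r)%R) by (pose proof (Cmod_ge_0 z); lra).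
set (b := fun n => (INR n * (INR n * Cmod (a n)) * r ^ n)%R).
assert (Hb : exists M : R, is_series b M).
{ apply ex_series_Rabs, CV_disk_inside.
  rewrite !(CV_radius_weight), Rabs_pos_eq by lra; exact Hr. }
destruct Hb as [M HM].
assert (HM0 := Rabs_pos M); pose proof (Rle_abs M) as HM1.
apply is_Cderive_intro; intros eps.
pose proof (cond_pos eps) as He.
assert (Hd : (0 < Rmin (r - Cmod z) (eps * (r * r) / (Rabs M + 1)))%R).
{ apply Rmin_glb_lt; [lra|].
  apply Rdiv_lt_0_compat; [|lra]; apply Rmult_lt_0_compat; [exact He|nra]. }
exists (mkposreal _ Hd); simpl; intros y Hy.
assert (H1 : (Cmod (y - z) < r - Cmod z)%R) by (eapply Rlt_le_trans; [apply Hy|apply Rmin_l]).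
assert (H2 : (Cmod (y - z) < eps * (r * r) / (Rabs M + 1))%R)
  by (eapply Rlt_le_trans; [apply Hy|apply Rmin_r]).
assert (Hyr : (Cmod y < r)%R) by (pose proof (Cmod_le_plus_minus y z); lra).
assert (HyC : Rbar_lt (Cmod y) (Cradius a)) 
  by exact (Rbar_lt_trans (Cmod y) r _ Hyr Hr).
set (h := Cmod (y - z)) in *.
assert (Hh : (0 <= h)%R) by apply Cmod_ge_0.
set (k := (h * h / (r * r))%R).
assert (HS : is_Cseries
  (fun n => a n * (y ^ n - z ^ n - (y - z) * (INR n * z ^ pred n)))
  (Cpseries a y - Cpseries a z - (y - z) * Cpseries (Cpderive a) z)).
{ eapply is_Cseries_ext.
  - apply is_Cseries_plus; [exact (Cpseries_correct _ _ HyC)|].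
    apply is_Cseries_plus.
    + exact (is_Cseries_scal (- (1)) _ _ (Cpseries_correct _ _ Hz)).
    + exact (is_Cseries_scal (- (y - z)) _ _ (Cpseries_derive_correct _ _ Hz)).
  - intros n; cbv beta; ring.
  - ring. }
apply Rle_trans with (k * M)%R.
- apply (Cmod_series_le _ (fun n => k * b n)%R _ _) with (2 := HS).
  + intros n; rewrite Cmod_mult.
    apply Rmult_le_reg_r with (r * r)%R; [nra|].
    rewrite Rmult_assoc.
    apply Rle_trans with
      (Cmod (a n) * (INR n * (INR n * r ^ n) * (h * h)))%R.
    * apply Rmult_le_compat_l; [apply Cmod_ge_0|].
      apply Cpow_taylor_bound; lra.
    * apply Req_le; unfold k, b; field; lra.
  + exact (@is_series_scal R_AbsRing R_NormedModule k b M HM).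
- unfold k.
  apply Rmult_le_reg_r with (r * r)%R; [nra|].
  replace (h * h / (r * r) * M * (r * r))%R with (h * (h * M))%R by (field; lra).
  replace (eps * h * (r * r))%R with (h * (eps * (r * r)))%R by ring.
  apply Rmult_le_compat_l; [exact Hh|].
  apply (Rmult_lt_compat_r (Rabs M + 1)) in H2; [|lra].
  replace (eps * (r * r) / (Rabs M + 1) * (Rabs M + 1))%R with (eps * (r * r))%R in H2
    by (field; lra).
  nra.
Qed.

(** * The hypergeometric equation *)

Definition hypergeom_coef (a b c : C) (n : nat) : C :=
  pochhammer a n * pochhammer b n / (pochhammer c n * pochhammer 1 n).

Lemma RtoC_INR_S_neq_0 (n : nat) : RtoC (INR (S n)) <> 0.
Proof. intros H; apply RtoC_inj in H; exact (not_0_INR (S n) (Nat.neq_succ_0 n) H). Qed.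

Lemma pochhammer_1_neq_0 (n : nat) : pochhammer 1 n <> 0.
Proof.
induction n as [|n IH]; [exact C1_nz|].
apply Cmult_neq_0; [exact IH|].
rewrite Cplus_comm, <- RtoC_plus, <- S_INR; apply RtoC_INR_S_neq_0.
Qed.

Lemma hypergeom_coef_S (a b c : C) (n : nat) :
  pochhammer c (S n) <> 0 ->
  (c + INR n) * INR (S n) * hypergeom_coef a b c (S n)
  = (a + INR n) * (b + INR n) * hypergeom_coef a b c n.
Proof.
intros Hc; pose proof (pochhammer_1_neq_0 (S n)) as H1.
unfold hypergeom_coef; simpl pochhammer in *.
rewrite S_INR, RtoC_plus.
assert (pochhammer c n <> 0) by (intros E; apply Hc; rewrite E; ring).
assert (c + INR n <> 0) by (intros E; apply Hc; rewrite E; ring).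
assert (pochhammer 1 n <> 0) by (intros E; apply H1; rewrite E; ring).
assert (INR n + 1 <> 0) by (intros E; apply H1; rewrite (Cplus_comm 1), E; ring).
field; repeat split; try assumption.
now rewrite Cplus_comm.
Qed.

(** With [theta = z d/dz], the recurrence of the coefficients says that
    [z F'' + c F'] and [(theta + a) (theta + b) F] have the same power series;
    the second one equals [z (z F'' + F') + (a + b) z F' + a b F]. *)
Lemma hypergeom_ode (a b c z : C) :
  (forall n, pochhammer c n <> 0) ->
  Rbar_lt (Cmod z) (Cradius (hypergeom_coef a b c)) ->
  let F := Cpseries (hypergeom_coef a b c) in
  let F1 := Cpseries (Cpderive (hypergeom_coef a b c)) in
  let F2 := Cpseries (Cpderive (Cpderive (hypergeom_coef a b c))) in
  z * (1 - z) * F2 z + (c - (a + b + 1) * z) * F1 z - a * b * F z = 0.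
Proof.
intros Hc Hz; cbv zeta.
set (u := hypergeom_coef a b c) in *.
assert (Hz1 : Rbar_lt (Cmod z) (Cradius (Cpderive u))) by now rewrite Cradius_derive.
assert (Hz2 : Rbar_lt (Cmod z) (Cradius (Cpderive (fun n => INR n * u n)))).
{ rewrite Cradius_derive; unfold Cradius in *.
  rewrite (CV_radius_ext _ (fun n => INR n * Cmod (u n))%R); [now rewrite CV_radius_weight|].
  intros n; rewrite Cmod_mult, Cmod_R, Rabs_pos_eq; [reflexivity|apply pos_INR]. }
pose proof (Cpseries_correct u z Hz) as S0.
pose proof (Cpseries_derive_shift u z Hz) as S1.
pose proof (Cpseries_correct (Cpderive u) z Hz1) as T1.
pose proof (Cpseries_derive_shift (Cpderive u) z Hz1) as T2.
set (F := Cpseries u z) in *; set (F1 := Cpseries (Cpderive u) z) in *.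
set (F2 := Cpseries (Cpderive (Cpderive u)) z) in *.
assert (S2 : is_Cseries (fun n => INR n * (INR n * u n) * z ^ n) (z * (z * F2 + F1))).
{ replace (z * F2 + F1) with (Cpseries (Cpderive (fun n => INR n * u n)) z).
  - apply Cpseries_derive_shift; rewrite <- Cradius_derive; exact Hz2.
  - apply Cpseries_unique.
    eapply is_Cseries_ext; [exact (is_Cseries_plus _ _ _ _ T2 T1)| |reflexivity].
    intros n; unfold Cpderive; cbv beta; rewrite S_INR, RtoC_plus; ring. }
assert (E : z * F2 + c * F1 = z * (z * F2 + F1) + ((a + b) * (z * F1) + a * b * F)).
{ eapply is_Cseries_unique.
  - exact (is_Cseries_plus _ _ _ _ T2 (is_Cseries_scal c _ _ T1)).
  - eapply is_Cseries_ext;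
      [exact (is_Cseries_plus _ _ _ _ S2 (is_Cseries_plus _ _ _ _
        (is_Cseries_scal (a + b) _ _ S1) (is_Cseries_scal (a * b) _ _ S0)))| |reflexivity].
    intros n; cbv beta; unfold Cpderive.
    pose proof (hypergeom_coef_S a b c n (Hc (S n))) as R; fold u in R.
    transitivity ((a + INR n) * (b + INR n) * u n * z ^ n); [ring|].
    rewrite <- R; ring. }
transitivity (z * F2 + c * F1 - (z * (z * F2 + F1) + ((a + b) * (z * F1) + a * b * F)));
  [ring|rewrite E; ring].
Qed.

(** The quotient of successive coefficients is [((n + 1/4) / (n + 1))^2 <= 1],
    so the coefficients are bounded by 1. *)
Lemma hypergeom_radius_quarter (z : C) :
  (Cmod z < 1)%R -> Rbar_lt (Cmod z) (Cradius (hypergeom_coef (1 / 4) (1 / 4) 1)).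
Proof.
set (u := hypergeom_coef (1 / 4) (1 / 4) 1).
intros Hz; apply Rbar_lt_le_trans with (1 : R); [exact Hz|].
assert (Hu : forall n, (Cmod (u n) <= 1)%R).
{ induction n as [|n IH].
  - unfold u, hypergeom_coef; simpl pochhammer.
    replace (1 * 1 / (1 * 1)) with (RtoC 1) by field.
    rewrite Cmod_1; lra.
  - pose proof (hypergeom_coef_S (1 / 4) (1 / 4) 1 n (pochhammer_1_neq_0 _)) as R.
    fold u in R; apply (f_equal Cmod) in R.
    pose proof (pos_INR n) as Hn.
    replace ((1 + INR n) * INR (S n)) with (RtoC ((1 + INR n) * (1 + INR n))) in R
      by (rewrite S_INR, !RtoC_mult, !RtoC_plus; ring).
    replace ((1 / 4 + INR n) * (1 / 4 + INR n)) with (RtoC ((1 / 4 + INR n) * (1 / 4 + INR n))) in R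
      by (rewrite !RtoC_mult, !RtoC_plus, RtoC_div; [ring|lra]).
    rewrite !Cmod_mult, !Cmod_R, !Rabs_pos_eq in R by nra.
    pose proof (Cmod_ge_0 (u n)); pose proof (Cmod_ge_0 (u (S n))).
    apply Rmult_le_reg_l with ((1 + INR n) * (1 + INR n))%R; [nra|].
    rewrite R; nra. }
apply (proj1 (CV_radius_bounded (fun n => Cmod (u n)))).
exists 1%R; intros n; rewrite pow1, Rmult_1_r, Rabs_pos_eq by apply Cmod_ge_0; apply Hu.
Qed.

(** * Uniqueness at a singular point *)

(** For two solutions of [(p y')' = q y], the function [p (y1 y2' - y2 y1')] has
    zero derivative and vanishes with [p] at 0.  Hence the Wronskian is zero
    where [p] is nonzero, which makes [y2 / y1] constant.  The conditions
    [d1 0 = d2 0 = 0] take care of the point 0, where [p] gives no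
    information. *)
Lemma wronskian_unique (p q y1 y2 d1 d2 : C -> C) (r : R) :
  (forall x, (Cmod x < r)%R -> is_Cderive y1 x (d1 x)) ->
  (forall x, (Cmod x < r)%R -> is_Cderive y2 x (d2 x)) ->
  (forall x, (Cmod x < r)%R -> is_Cderive (fun t => p t * d1 t) x (q x * y1 x)) ->
  (forall x, (Cmod x < r)%R -> is_Cderive (fun t => p t * d2 t) x (q x * y2 x)) ->
  p 0 = 0 -> (forall x, (Cmod x < r)%R -> x <> 0 -> p x <> 0) ->
  d1 0 = 0 -> d2 0 = 0 -> y1 0 = y2 0 ->
  (forall x, (Cmod x < r)%R -> y1 x <> 0) ->
  forall x, (Cmod x < r)%R -> y1 x = y2 x.
Proof.
intros Hy1 Hy2 Hd1 Hd2 Hp0 Hp Hd10 Hd20 Hy0 Hnz.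
assert (HW : forall x, (Cmod x < r)%R ->
  y1 x * (p x * d2 x) - y2 x * (p x * d1 x) = 0).
{ intros x Hx.
  rewrite (is_Cderive_zero_const
    (fun t => y1 t * (p t * d2 t) - y2 t * (p t * d1 t)) r); [|clear x Hx|exact Hx].
  - cbv beta; rewrite Hp0; ring.
  - intros x Hx; eapply is_Cderive_eq.
    + apply is_Cderive_minus;
        [exact (is_Cderive_mult _ _ _ _ _ (Hy1 x Hx) (Hd2 x Hx))
        |exact (is_Cderive_mult _ _ _ _ _ (Hy2 x Hx) (Hd1 x Hx))].
    + cbv beta; ring. }
assert (HD : forall x, (Cmod x < r)%R -> y1 x * d2 x - y2 x * d1 x = 0).
{ intros x Hx.
  destruct (Ceq_dec x 0) as [->|Hx0]; [rewrite Hd10, Hd20; ring|].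
  specialize (HW x Hx); specialize (Hp x Hx Hx0).
  replace (y1 x * d2 x - y2 x * d1 x)
    with ((y1 x * (p x * d2 x) - y2 x * (p x * d1 x)) / p x) by (now field).
  rewrite HW; now field. }
intros x Hx.
assert (H0 : (Cmod 0 < r)%R).
{ rewrite Cmod_0; pose proof (Cmod_ge_0 x); lra. }
assert (E : y2 x / y1 x = 1).
{ rewrite (is_Cderive_zero_const (fun t => y2 t / y1 t) r); [|clear x Hx|exact Hx].
  - cbv beta; rewrite <- Hy0; field; now apply Hnz.
  - intros x Hx; eapply is_Cderive_eq.
    + exact (is_Cderive_div _ _ _ _ _ (Hy2 x Hx) (Hy1 x Hx) (Hnz x Hx)).
    + pose proof (Hnz x Hx) as Hx1.
      transitivity ((y1 x * d2 x - y2 x * d1 x) / (y1 x * y1 x)); [now field|].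
      rewrite (HD x Hx); now field. }
pose proof (Hnz x Hx).
replace (y2 x) with (y2 x / y1 x * y1 x) by (now field).
rewrite E; ring.
Qed.

(** * The Landen transformation *)

(** These are the two arguments [1 - w^2] and
    [1 - (6 s - w - 3)^2 / (2 s + w + 3)^2] in the parameter
    [x = (2 - s) / (2 + s)]. *)
Definition landen_src (x : C) : C := 16 * x * (1 - x) ^ 2 / (1 + x) ^ 4.
Definition landen_tgt (x : C) : C := 4 * x ^ 2 * (1 - x ^ 2).

(** Dispatching on the syntax of the function, rather than trying the rules in
    turn, keeps unification from unfolding complex arithmetic. *)
Ltac Cderive :=
  lazymatch goal with
  | |- is_Cderive (fun _ => ?c) _ _ => exact (is_Cderive_const c _)
  | |- is_Cderive (fun x => x) _ _ => exact (is_Cderive_id _)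
  | |- is_Cderive (fun x => @?f x + @?g x) _ _ =>
      eapply (is_Cderive_plus f g); Cderive
  | |- is_Cderive (fun x => @?f x - @?g x) _ _ =>
      eapply (is_Cderive_minus f g); Cderive
  | |- is_Cderive (fun x => @?f x * @?g x) _ _ =>
      eapply (is_Cderive_mult f g); Cderive
  | |- is_Cderive (fun x => @?f x / @?g x) _ _ =>
      eapply (is_Cderive_div f g); [Cderive|Cderive|]
  | |- is_Cderive (fun x => @?f x ^ ?n) _ _ =>
      eapply (is_Cderive_pow f); Cderive
  | |- is_Cderive (fun x => ?F (@?g x)) _ _ =>
      eapply (is_Cderive_comp F g); [|Cderive]
  | _ => idtac
  end.

Lemma landen_src_derive (x : C) : 1 + x <> 0 ->
  is_Cderive landen_src x (16 * (1 - x) * (1 - 6 * x + x ^ 2) / (1 + x) ^ 5).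
Proof.
intros Hx; unfold landen_src; eapply is_Cderive_eq.
- Cderive; now apply Cpow_nz.
- cbv beta; simpl INR; simpl pred; rewrite ?RtoC_plus; field; exact Hx.
Qed.

Lemma landen_tgt_derive (x : C) :
  is_Cderive landen_tgt x (8 * x * (1 - 2 * x ^ 2)).
Proof.
unfold landen_tgt; eapply is_Cderive_eq.
- Cderive.
- cbv beta; simpl INR; simpl pred; rewrite ?RtoC_plus; ring.
Qed.

(** Each side [y] solves [(x (1 - x^2) y')' = x y]: after the chain rule, the
    left-hand side minus the right-hand side is a regular multiple of the
    hypergeometric equation of [F] at the inner argument.  At 0 the equation
    degenerates to [F' 0 = F 0 / 16], exactly what makes the derivative of
    [F (landen_src x) / (1 + x)] vanish there. *)
Lemma hypergeom_landen_of_ode (F F1 F2 : C -> C) :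
  (forall z, (Cmod z < 1)%R -> is_Cderive F z (F1 z)) ->
  (forall z, (Cmod z < 1)%R -> is_Cderive F1 z (F2 z)) ->
  (forall z, (Cmod z < 1)%R ->
    z * (1 - z) * F2 z + (1 - (1 / 4 + 1 / 4 + 1) * z) * F1 z
      - 1 / 4 * (1 / 4) * F z = 0) ->
  F 0 <> 0 ->
  exists d : posreal, forall x, (Cmod x < d)%R ->
    F (landen_src x) / (1 + x) = F (landen_tgt x).
Proof.
intros HF HF1 Hode HF0.
assert (H01 : (Cmod 0 < 1)%R) by (rewrite Cmod_0; lra).
assert (Hs0 : landen_src 0 = 0) by (unfold landen_src; field; now rewrite Cplus_0_r; apply C1_nz).
assert (Ht0 : landen_tgt 0 = 0) by (unfold landen_tgt; ring).
assert (H10 : F1 0 = F 0 / 16).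
{ specialize (Hode 0 H01).
  transitivity (F1 0 - (0 * (1 - 0) * F2 0 + (1 - (1 / 4 + 1 / 4 + 1) * 0) * F1 0
      - 1 / 4 * (1 / 4) * F 0)); [rewrite Hode; ring|field]. }
assert (H10' : 1 + 0 <> 0) by (rewrite Cplus_0_r; apply C1_nz).
destruct (is_Cderive_continuous _ _ _ (landen_src_derive 0 H10')
  (mkposreal 1 Rlt_0_1)) as [r1 Hr1].
destruct (is_Cderive_continuous _ _ _ (landen_tgt_derive 0)
  (mkposreal 1 Rlt_0_1)) as [r2 Hr2].
assert (Hy0 : is_Cderive (fun x => F (landen_tgt x)) 0
   (8 * 0 * (1 - 2 * 0 ^ 2) * F1 (landen_tgt 0))).
{ apply is_Cderive_comp; [apply HF; now rewrite Ht0|apply landen_tgt_derive]. }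
destruct (is_Cderive_continuous _ _ _ Hy0
  (mkposreal _ (proj1 (Cmod_gt_0 _) HF0))) as [r3 Hr3].
rewrite Hs0 in Hr1; rewrite Ht0 in Hr2, Hr3; simpl pos in Hr1, Hr2, Hr3.
set (r := Rmin (Rmin r1 r2) (Rmin r3 1)).
assert (Hr : (0 < r)%R).
{ pose proof (cond_pos r1); pose proof (cond_pos r2); pose proof (cond_pos r3).
  unfold r; repeat apply Rmin_glb_lt; lra. }
assert (Hdom : forall x, (Cmod x < r)%R ->
  (Cmod (landen_src x) < 1)%R /\ (Cmod (landen_tgt x) < 1)%R /\
  F (landen_tgt x) <> 0 /\ 1 + x <> 0 /\ 1 - x <> 0).
{ intros x Hx; unfold r in Hx.
  assert (M1 := Rmin_l (Rmin r1 r2) (Rmin r3 1)).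
  assert (M2 := Rmin_r (Rmin r1 r2) (Rmin r3 1)).
  assert (M3 := Rmin_l r1 r2). assert (M4 := Rmin_r r1 r2).
  assert (M5 := Rmin_l r3 1). assert (M6 := Rmin_r r3 1).
  assert (E0 : forall t : C, t - 0 = t) by (intros t; ring).
  specialize (Hr1 x); specialize (Hr2 x); specialize (Hr3 x).
  rewrite !E0 in Hr1, Hr2; rewrite E0 in Hr3.
  split; [apply Hr1; lra|]. split; [apply Hr2; lra|]. split; [|split].
  - intros E; rewrite E in Hr3.
    replace (0 - F 0) with (- F 0) in Hr3 by ring; rewrite Cmod_opp in Hr3.
    apply (Rlt_irrefl (Cmod (F 0))), Hr3; lra.
  - intros E; replace x with (1 + x - 1) in Hx by ring; rewrite E in Hx.
    replace (0 - 1) with (- (1)) in Hx by ring; rewrite Cmod_m1 in Hx; lra.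
  - intros E; replace x with (1 - (1 - x)) in Hx by ring; rewrite E in Hx.
    rewrite E0, Cmod_1 in Hx; lra. }
exists (mkposreal r Hr); intros x Hx; simpl in Hx; symmetry; revert x Hx.
apply (wronskian_unique
  (fun x => x * (1 - x ^ 2)) (fun x => x)
  (fun x => F (landen_tgt x)) (fun x => F (landen_src x) / (1 + x))
  (fun x => 8 * x * (1 - 2 * x ^ 2) * F1 (landen_tgt x))
  (fun x => 16 * (1 - x) * (1 - 6 * x + x ^ 2) / (1 + x) ^ 6 * F1 (landen_src x)
            - F (landen_src x) / (1 + x) ^ 2)).
- intros x Hx; destruct (Hdom x Hx) as (_ & H2 & _).
  exact (is_Cderive_comp F landen_tgt x _ _ (HF _ H2) (landen_tgt_derive x)).
- intros x Hx; destruct (Hdom x Hx) as (H1 & _ & _ & H4 & _).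
  eapply is_Cderive_eq.
  + Cderive; [exact (HF _ H1)|exact (landen_src_derive x H4)|exact H4].
  + cbv beta; field; exact H4.
- intros x Hx; destruct (Hdom x Hx) as (_ & H2 & _).
  eapply is_Cderive_eq.
  + Cderive; [exact (HF1 _ H2)|exact (landen_tgt_derive x)].
  + pose proof (Hode _ H2) as O; cbv beta; simpl INR; simpl pred; rewrite ?RtoC_plus.
    revert O; generalize (F (landen_tgt x)) (F1 (landen_tgt x)) (F2 (landen_tgt x)).
    unfold landen_tgt; intros f f1 f2 O.
    (* The factor is [x (1 - x^2) t'^2 / (t (1 - t))] for [t = landen_tgt x]. *)
    match type of O with ?e = _ => transitivity (x * f + 16 * x * e) end;
      [field|rewrite O; ring].
- intros x Hx; destruct (Hdom x Hx) as (H1 & _ & _ & H4 & _).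
  eapply is_Cderive_eq.
  + Cderive;
      try exact (HF _ H1); try exact (HF1 _ H1); try exact (landen_src_derive x H4);
      now apply Cpow_nz.
  + pose proof (Hode _ H1) as O; cbv beta; simpl INR; simpl pred; rewrite ?RtoC_plus.
    revert O; generalize (F (landen_src x)) (F1 (landen_src x)) (F2 (landen_src x)).
    unfold landen_src; intros f f1 f2 O.
    (* The factor is [x (1 - x) t'^2 / (t (1 - t))] for [t = landen_src x]. *)
    match type of O with ?e = _ =>
      transitivity (x * (f / (1 + x)) + 16 * (1 - x) / (1 + x) ^ 2 * e) end;
      [field; exact H4|rewrite O; field; exact H4].
- ring.
- intros x Hx Hx0; destruct (Hdom x Hx) as (_ & _ & _ & H4 & H5).
  replace (1 - x ^ 2) with ((1 - x) * (1 + x)) by ring.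
  repeat apply Cmult_neq_0; assumption.
- ring.
- rewrite Hs0, H10; field; exact H10'.
- rewrite Hs0, Ht0; field; exact H10'.
- intros x Hx; apply Hdom, Hx.
Qed.

Lemma hypergeom_landen : exists d : posreal, forall x : C, (Cmod x < d)%R ->
  hypergeom (1 / 4) (1 / 4) 1 (landen_src x) / (1 + x)
  = hypergeom (1 / 4) (1 / 4) 1 (landen_tgt x).
Proof.
set (u := hypergeom_coef (1 / 4) (1 / 4) 1).
assert (Hrad : forall z, (Cmod z < 1)%R -> Rbar_lt (Cmod z) (Cradius u))
  by exact hypergeom_radius_quarter.
apply (hypergeom_landen_of_ode (Cpseries u) (Cpseries (Cpderive u))
  (Cpseries (Cpderive (Cpderive u)))).
- intros z Hz; apply is_Cderive_pseries, Hrad, Hz.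
- intros z Hz; apply is_Cderive_pseries; rewrite Cradius_derive; apply Hrad, Hz.
- intros z Hz.
  exact (hypergeom_ode (1 / 4) (1 / 4) 1 z pochhammer_1_neq_0 (Hrad z Hz)).
- rewrite Cpseries_0.
  + unfold u, hypergeom_coef; simpl pochhammer.
    replace (1 * 1 / (1 * 1)) with (RtoC 1) by field; exact C1_nz.
  + rewrite <- Cmod_0; apply Hrad; rewrite Cmod_0; lra.
Qed.

Theorem theorem5p1 (s : C -> C)
    (hs : is_sqrt_branch (fun w => 2 + 2 * w) s 1 2) :
  locally (1 : C) (fun w : C =>
    (2 + s w) / 4 * hypergeom (1 / 4) (1 / 4) 1 (1 - w ^ 2)
    = hypergeom (1 / 4) (1 / 4) 1
        (1 - (6 * s w - w - 3) ^ 2 / (2 * s w + w + 3) ^ 2)).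
Proof.
destruct hs as [Hs1 Hs].
destruct hypergeom_landen as [d Hd].
assert (He : (0 < Rmin 1 d)%R) by (apply Rmin_glb_lt; [lra|apply cond_pos]).
assert (Hnear : locally (1 : C) (fun w : C => (Cmod (s w - 2) < Rmin 1 d)%R)).
{ apply (proj1 (locally_singleton _ _ Hs) (fun v : C => (Cmod (v - 2) < Rmin 1 d)%R)).
  rewrite Hs1.
  apply (@locally_le_locally_norm C_AbsRing C_NormedModule).
  exists (mkposreal _ He); intros v Hv; exact Hv. }
generalize (filter_and _ _ Hs Hnear); apply filter_imp; clear - Hd.
intros w [[_ Hsq] Hsw]; change C in (type of w).
pose proof (Rmin_l 1 d) as M1; pose proof (Rmin_r 1 d) as M2.
set (v := s w) in *.
(* The bound 1 on [Cmod (v - 2)] keeps the denominator [2 + v] of [x] away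
   from 0; the bound [d] then makes [x] small. *)
assert (Hv : (3 < Cmod (2 + v))%R).
{ pose proof (Cmod_le_plus_minus 4 (2 + v)) as H4.
  rewrite Cmod_R, Rabs_pos_eq in H4 by lra.
  replace (4 - (2 + v)) with (2 - v) in H4 by ring.
  rewrite Cmod_minus_sym in H4; lra. }
assert (Hv0 : 2 + v <> 0) by (apply Cmod_gt_0; lra).
assert (Hw : w = v * v / 2 - 1) by (rewrite Hsq; field).
set (x := (2 - v) / (2 + v)).
assert (Hx : (Cmod x < d)%R).
{ unfold x; rewrite Cmod_div, Cmod_minus_sym by exact Hv0.
  apply Rmult_lt_reg_r with (Cmod (2 + v)); [lra|].
  replace (Cmod (v - 2) / Cmod (2 + v) * Cmod (2 + v))%R with (Cmod (v - 2))
    by (field; lra).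
  pose proof (Cmod_ge_0 (v - 2)); nra. }
assert (H1x : 1 + x = 4 / (2 + v)) by (unfold x; now field).
assert (H4 : RtoC 4 <> 0) by (intros E; apply RtoC_inj in E; lra).
specialize (Hd x Hx).
replace (1 - w ^ 2) with (landen_src x).
2:{ unfold landen_src; rewrite H1x, Hw; unfold x; field; auto. }
replace (1 - (6 * v - w - 3) ^ 2 / (2 * v + w + 3) ^ 2) with (landen_tgt x).
2:{ replace (2 * v + w + 3) with ((2 + v) ^ 2 / 2) by (rewrite Hw; field).
    unfold landen_tgt, x; rewrite Hw; field; auto. }
rewrite <- Hd, H1x; field; auto.
Qed.
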